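(* Let $n\ge0$ and $k$ be integers, and for integers $a,b$ with $a\equiv b\pmod 2$ set $$S(a,b)=\sum_{i=0}^{\frac{a-|b|}{2}}\binom{\frac{a-|b|}{2}-i}{i}\binom{\frac{a-|b|}{2}-i}{|b|+i}.$$ (1) If $n\equiv k\pmod2$ and $(n,k)\neq(0,0)$, then $|\mathcal{Z}_{n,k}|=2S(n,k)$. (2) If $n\not\equiv k\pmod 2$, then $$|\mathcal{Z}_{n,k}|=|\mathcal{Z}_{n-1,k-2}^+|+|\mathcal{Z}_{n-2,k-1}^+|+|\mathcal{Z}_{n-1,k+2}^-|+|\mathcal{Z}_{n-2,k+1}^-|,$$ where each of the four terms on the right is given by the formula without the factor $2$, i.e. $|\mathcal{Z}_{a,b}^{+}|=S(a,b)$ and $|\mathcal{Z}_{a,b}^{-}|=S(a,b)$ for the respective indices $(a,b)$.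
   Context: A grand zigzag knight's path is a lattice path in $\mathbb{Z}^2$ starting at the origin, made of steps $N=(1,2)$, $\bar N=(1,-2)$, $E=(2,1)$, $\bar E=(2,-1)$, such that the vertical components of two consecutive steps never have the same direction (up-steps $N,E$ and down-steps $\bar N,\bar E$ alternate). The size is the $x$-coordinate and the altitude the $y$-coordinate of the last point. $\mathcal{Z}_{n,k}$ is the set of grand zigzag knight's paths of size $n$ and altitude $k$ (empty if $n<0$), and $\mathcal{Z}_{n,k}^+$ (resp. $\mathcal{Z}_{n,k}^-$) is its subset of paths starting with $E$ or $N$ (resp. with $\bar E$ or $\bar N$), with the convention that the empty path belongs to both $\mathcal{Z}_{0,0}^+$ and $\mathcal{Z}_{0,0}^-$. A sum with upper limit less than its lower limit is $0$, and $\binom{a}{b}=0$ if $b<0$ or $b>a\ge0$. *)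

(* Defs.v *)
From mathcomp Require Import all_boot all_order all_algebra.
From mathcomp Require Import finmap.
From mathcomp Require Import all_classical.

Set Implicit Arguments.
Unset Strict Implicit.
Unset Printing Implicit Defensive.

Import Order.TTheory GRing.Theory Num.Theory.

Local Open Scope ring_scope.
Local Open Scope classical_set_scope.

Definition stepN : int * int := (1, 2).
Definition stepNbar : int * int := (1, -2).
Definition stepE : int * int := (2, 1).
Definition stepEbar : int * int := (2, -1).

Definition knight_steps : seq (int * int) :=
  [:: stepN; stepNbar; stepE; stepEbar].

Definition is_up (s : int * int) : bool := 0 < s.2.

(* A path starts at the origin, so it is encoded by its sequence of steps. *)
Definition grand_zigzag (p : seq (int * int)) : bool :=
  all (fun s => s \in knight_steps) p &&
  sorted (fun s t => is_up s != is_up t) p.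

Definition path_size (p : seq (int * int)) : int := \sum_(s <- p) s.1.
Definition path_altitude (p : seq (int * int)) : int := \sum_(s <- p) s.2.

Definition zigzag (n k : int) : set (seq (int * int)) :=
  [set p | [/\ grand_zigzag p, path_size p = n & path_altitude p = k]].

(* The empty path satisfies both conditions on the first step. *)
Definition zigzag_plus (n k : int) : set (seq (int * int)) :=
  [set p | zigzag n k p /\
    (if p is s :: _ then s \in [:: stepE; stepN] else true)].

Definition zigzag_minus (n k : int) : set (seq (int * int)) :=
  [set p | zigzag n k p /\
    (if p is s :: _ then s \in [:: stepEbar; stepNbar] else true)].

(* [fset_set] sends infinite sets to the empty one; the lemmas [finite_zigzag],
   [finite_zigzag_plus] and [finite_zigzag_minus] show that this does not
   occur for the sets counted here. *)
Definition set_card (A : set (seq (int * int))) : nat := #|` fset_set A |%fset.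

(* [Ssum a b] is used for a = b mod 2, when the division by 2 is exact; if the
   upper limit of the sum is negative, the sum is empty. *)
Definition Ssum (a b : int) : nat :=
  if ((a - `|b|) %/ 2)%Z is Posz h then
    (\sum_(0 <= i < h.+1) 'C(h - i, i) * 'C(h - i, `|b| + i))%N
  else 0%N.

Lemma length_le_path_size (p : seq (int * int)) :
  all (fun s => s \in knight_steps) p -> (size p)%:Z <= path_size p.
Proof.
rewrite /path_size; elim: p => [|s p IHp] /=; first by rewrite big_nil.
case/andP=> hs /IHp{}IHp; rewrite big_cons -add1n PoszD lerD //.
by move: hs; rewrite !inE => /or4P[] /eqP->.
Qed.

Lemma finite_zigzag (n k : int) : finite_set (zigzag n k).
Proof.
pose m := `|n|%N.
apply: (@sub_finite_set _ _
  [set map (fun i : 'I_4 => nth stepN knight_steps i) (val t)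
  | t in [set: {bseq m of 'I_4}]]); last first.
  by apply: finite_image; apply: finite_finset.
move=> p [/andP[hp _] hn _] /=.
have szp : (size p <= m)%N.
  by move: (length_le_path_size hp); rewrite hn /m; case: (n) => // q.
pose f s : 'I_4 := inord (index s knight_steps).
have szf : (size (map f p) <= m)%N by rewrite size_map.
exists (Bseq szf) => //=.
rewrite -map_comp -[RHS]map_id; apply/eq_in_map => s /(allP hp) hs /=.
by rewrite inordK ?nth_index // -[4%N]/(size knight_steps) index_mem.
Qed.

Lemma finite_zigzag_plus (n k : int) : finite_set (zigzag_plus n k).
Proof. by apply: (sub_finite_set _ (finite_zigzag n k)) => p []. Qed.

Lemma finite_zigzag_minus (n k : int) : finite_set (zigzag_minus n k).
Proof. by apply: (sub_finite_set _ (finite_zigzag n k)) => p []. Qed.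

(* Main.v *)
(** A path with an even number [2 m] of steps that starts upwards is a word of
    [m] pairs (up step, down step), all chosen independently.  If [a] of the up
    steps are [E] and [c] of the down steps are [Ebar], then its size is
    [2 m + a + c] and its altitude is [c - a].  Hence, when [n - |k| = 2 h], the
    smaller of [a] and [c] is some [i <= h], the larger is [|k| + i] and
    [m = h - i], which gives the term of index [i] of [Ssum n k].  Reflection in
    the horizontal axis exchanges the paths starting upwards and downwards.  The
    number of steps has the parity of [n + k], so for [n <> k] modulo 2 a path
    ends in the direction in which it starts, and deleting its last step
    reduces to the even case. *)
Require Import Defs.
From mathcomp Require Import all_boot all_order all_algebra.
From mathcomp Require Import finmap.
From mathcomp Require Import all_classical.
From mathcomp Require Import zify.

Import Order.TTheory GRing.Theory Num.Theory.

Local Open Scope ring_scope.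

(** * Cardinalities of finite sets of paths *)

Lemma set_card_image (f : seq (int * int) -> seq (int * int))
    (A : set (seq (int * int))) :
  injective f -> finite_set A -> set_card (f @` A)%classic = set_card A.
Proof.
by move=> f_inj finA; rewrite /set_card fset_set_image // card_imfset.
Qed.

Lemma set_card_setU (A B : set (seq (int * int))) :
  finite_set A -> finite_set B -> (forall p, A p -> B p -> False) ->
  set_card (A `|` B)%classic = (set_card A + set_card B)%N.
Proof.
move=> finA finB dAB; rewrite /set_card fset_setU // cardfsU.
suff -> : (fset_set A `&` fset_set B = fset0)%fset by rewrite cardfs0 subn0.
apply/fsetP => p; rewrite in_fsetI !in_fset_set // in_fset0.
by apply/andP => -[/set_mem Ap /set_mem Bp]; apply: (dAB p).
Qed.

Lemma set_card_seq (A : set (seq (int * int))) (s : seq (seq (int * int))) :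
  uniq s -> (forall p, A p <-> p \in s) -> set_card A = size s.
Proof.
move=> s_uniq sE; rewrite /set_card.
have finA : finite_set A.
  by apply: (sub_finite_set _ (finite_seq s)) => p /sE.
have -> : fset_set A = [fset p in s]%fset.
  by apply/fsetP => p; rewrite in_fset_set // inE; apply/idP/idP; rewrite inE => /sE.
by rewrite card_fseq undup_id.
Qed.

(** * Bit words with a prescribed number of ones *)

(** The recursion mirrors Pascal's rule, so the length of the list is a binomial coefficient by
    construction. *)
Fixpoint bits (m j : nat) : seq bitseq :=
  match m, j with
  | 0, 0 => [:: [::]]
  | 0, _.+1 => [::]
  | m'.+1, 0 => map (cons false) (bits m' 0)
  | m'.+1, j'.+1 =>
      map (cons false) (bits m' j'.+1) ++ map (cons true) (bits m' j')
  end.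

Lemma size_bits (m j : nat) : size (bits m j) = 'C(m, j).
Proof.
elim: m j => [|m IHm] [|j] //=; first by rewrite size_map IHm !bin0.
by rewrite size_cat !size_map !IHm binS.
Qed.

Lemma mem_map_cons (b c : bool) (u : bitseq) (s : seq bitseq) :
  ((b :: u) \in map (cons c) s) = (b == c) && (u \in s).
Proof.
apply/mapP/andP => [[v vs [-> ->]]|[/eqP-> us]]; first by rewrite eqxx.
by exists u.
Qed.

Lemma nil_map_cons (c : bool) (s : seq bitseq) : ([::] \in map (cons c) s) = false.
Proof. by apply/mapP => -[]. Qed.

Lemma mem_bits (m j : nat) (u : bitseq) :
  (u \in bits m j) = (size u == m) && (count id u == j).
Proof.
elim: m j u => [|m IHm] [|j] [|b u] //=.
- by rewrite nil_map_cons.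
- by rewrite mem_map_cons IHm eqSS; case: b; rewrite ?andbF.
- by rewrite mem_cat !nil_map_cons.
- by rewrite mem_cat !mem_map_cons !IHm eqSS; case: b; rewrite ?orbF.
Qed.

Lemma uniq_bits (m j : nat) : uniq (bits m j).
Proof.
have consI c : injective (cons c : bitseq -> bitseq) by move=> u v [].
elim: m j => [|m IHm] [|j] //=; first by rewrite map_inj_uniq.
rewrite cat_uniq !map_inj_uniq // !IHm andbT /=.
by apply/hasPn => _ /mapP[u _ ->]; rewrite mem_map_cons.
Qed.

(** * Coding paths of even length by words of pairs *)

(* A pair codes an up step and the next down step, [true] marking the longer
   horizontal move ([E] or [Ebar]). *)
Definition weave (w : seq (bool * bool)) : seq (int * int) :=
  flatten [seq [:: if q.1 then stepE else stepN;
                   if q.2 then stepEbar else stepNbar] | q <- w].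

(** A test of direction instead of membership in [[:: stepE; stepN]]: the two agree on knight steps,
    and direction is what alternation controls. *)
Definition starts_up (p : seq (int * int)) : bool :=
  if p is s :: _ then is_up s else true.

Lemma path_size_cons s p : path_size (s :: p) = s.1 + path_size p.
Proof. by rewrite /path_size big_cons. Qed.

Lemma path_altitude_cons s p : path_altitude (s :: p) = s.2 + path_altitude p.
Proof. by rewrite /path_altitude big_cons. Qed.

Lemma grand_zigzag_cons s p :
  grand_zigzag (s :: p) =
  [&& s \in knight_steps, grand_zigzag p &
      if p is t :: _ then is_up s != is_up t else true].
Proof.
rewrite /grand_zigzag; case: p => [|t p] /=; first by rewrite !andbT.
by rewrite -!andbA; do !bool_congr.
Qed.

Lemma weave_inj : injective weave.
Proof.
elim=> [|[a b] w IHw] [|[c d] w'] //=.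
by rewrite /weave /= => -[]; case: a b c d => [] [] [] [] // _ _ /IHw ->.
Qed.

Lemma size_weave w : size (weave w) = (size w).*2.
Proof. by elim: w => //= q w; rewrite /weave /= => ->. Qed.

Lemma path_size_weave w :
  path_size (weave w) =
  ((size w).*2 + count id (unzip1 w) + count id (unzip2 w))%N.
Proof.
elim: w => [|[a b] w IHw]; first by rewrite /path_size big_nil.
by rewrite /weave /= !path_size_cons -/(weave w) IHw; case: a b => [] [] /=; lia.
Qed.

Lemma path_altitude_weave w :
  path_altitude (weave w) =
  (count id (unzip2 w))%:Z - (count id (unzip1 w))%:Z.
Proof.
elim: w => [|[a b] w IHw]; first by rewrite /path_altitude big_nil.
rewrite /weave /= !path_altitude_cons -/(weave w) IHw.
by case: a b => [] [] /=; lia.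
Qed.

Lemma weave_starts_up w : starts_up (weave w).
Proof. by case: w => [|[[] b] w]. Qed.

Lemma weave_zigzag w : grand_zigzag (weave w).
Proof.
elim: w => [|[a b] w IHw] //; rewrite /weave /= !grand_zigzag_cons -/(weave w) IHw.
by case: w {IHw} => [|[c d] w]; case: a b => [] []; rewrite //; case: c.
Qed.

Lemma up_step s : s \in knight_steps -> is_up s ->
  exists b : bool, s = if b then stepE else stepN.
Proof. by rewrite !inE => /or4P[] /eqP-> // _; [exists false | exists true]. Qed.

Lemma down_step s : s \in knight_steps -> ~~ is_up s ->
  exists b : bool, s = if b then stepEbar else stepNbar.
Proof. by rewrite !inE => /or4P[] /eqP-> // _; [exists false | exists true]. Qed.

(** Strong induction on the length, two steps at a time: by alternation the second step goes down,
    so what remains again starts upwards. *)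
Lemma even_zigzagP p :
  grand_zigzag p -> starts_up p -> ~~ odd (size p) -> exists w, p = weave w.
Proof.
have [m] := ubnP (size p); elim: m p => // m IHm [|s [|t p]] //=.
  by exists [::].
rewrite !grand_zigzag_cons negbK ltnS => ltp /and3P[hs /and3P[ht hp hpt] hst] us.
have dt : is_up t = false by move: hst; rewrite us; case: (is_up t).
move=> evp.
have [||||w ->] := IHm p => //; first exact: ltnW.
  by case: p hpt {ltp hp evp} => //= r p; rewrite dt; case: (is_up r).
have [a ->] := up_step _ hs us; have [|b ->] := down_step _ ht; first by rewrite dt.
by exists ((a, b) :: w).
Qed.

Lemma zigzag_plusE n k p : zigzag_plus n k p <-> zigzag n k p /\ starts_up p.
Proof.
split=> -[[zp np kp] up]; split=> //; case: p zp up {np kp} => // s p.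
  by move=> _; rewrite !inE => /orP[] /eqP->.
by rewrite grand_zigzag_cons => /andP[hs _] /(up_step _ hs)[[] ->].
Qed.

(** Up and down steps are chosen independently, so the words of [m] pairs with [a] steps [E] and [b]
    steps [Ebar] form a product of two lists of bit words. *)
Lemma mem_zip_bits (m a b : nat) (w : seq (bool * bool)) :
  (w \in [seq zip u v | u <- bits m a, v <- bits m b]) =
  [&& size w == m, count id (unzip1 w) == a & count id (unzip2 w) == b].
Proof.
apply/allpairsP/and3P => [[[u v] /= []]|[/eqP sw wa wb]].
  rewrite !mem_bits => /andP[/eqP su ua] /andP[/eqP sv vb] ->.
  by rewrite unzip1_zip ?unzip2_zip ?size_zip ?su ?sv ?minnn.
exists (unzip1 w, unzip2 w); rewrite /= !mem_bits !size_map sw eqxx wa wb.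
by rewrite zip_unzip.
Qed.

Lemma uniq_zip_bits (m a b : nat) :
  uniq [seq zip u v | u <- bits m a, v <- bits m b].
Proof.
apply: allpairs_uniq; try exact: uniq_bits.
move=> [u v] [u' v'] /allpairsP[[x y] /= []] + + [-> ->].
rewrite !mem_bits => /andP[/eqP sx _] /andP[/eqP sy _].
case/allpairsP => -[x' y'] /= [] + + [-> ->].
rewrite !mem_bits => /andP[/eqP sx' _] /andP[/eqP sy' _] e.
(* All four components have length [m], so zipping loses nothing and can be undone. *)
move/(congr1 (fun w => (unzip1 w, unzip2 w))): e.
by rewrite /= !unzip1_zip ?unzip2_zip ?sx ?sy ?sx' ?sy'.
Qed.

(** * Parity of the length and the even case *)

(** The coordinates of each step have an odd sum: 3 for [N] and [E], -1 for [Nbar], 1 for [Ebar]. *)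
Lemma size_parity (p : seq (int * int)) : all (fun s => s \in knight_steps) p ->
  exists q : int, path_size p + path_altitude p = (size p)%:Z + 2 * q.
Proof.
elim: p => [|s p IHp] /=; first by exists 0; rewrite /path_size /path_altitude !big_nil.
case/andP => hs /IHp[q hq]; rewrite path_size_cons path_altitude_cons.
move: hs; rewrite !inE => /or4P[] /eqP->; [exists (q + 1) | exists (q - 1) |
  exists (q + 1) | exists q]; by rewrite /=; lia.
Qed.

Lemma zigzag_odd n k p : zigzag n k p -> odd (size p) = ((n != k %[mod 2])%Z).
Proof.
case=> /andP[/size_parity[q hq] _] hn hk.
by move: hq; rewrite hn hk; lia.
Qed.

Lemma set_card_zigzag_plus (n k : int) :
  (n = k %[mod 2])%Z -> set_card (zigzag_plus n k) = Ssum n k.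
Proof.
move=> nk.
have weaveP p : zigzag_plus n k p <->
    exists2 w, p = weave w & path_size p = n /\ path_altitude p = k.
  rewrite zigzag_plusE; split=> [[zp up]|[w ->] [hn hk]]; last first.
    by split; [split=> //; exact: weave_zigzag | exact: weave_starts_up].
  have ep : ~~ odd (size p) by rewrite (zigzag_odd _ _ _ zp) negbK; apply/eqP.
  by case: zp => zp hn hk; have [w pw] := even_zigzagP p zp up ep; exists w.
rewrite /Ssum; set e := ((n - `|k|) %/ 2)%Z.
have ne : n = `|k| + 2 * e by rewrite /e; lia.
move: {nk} e ne => [h|h] ne; last first.
  (* Size minus absolute altitude is never negative on a woven path, so the set is empty, in
     agreement with the default 0 of [Ssum]. *)
  rewrite (@set_card_seq _ [::]) // => p; split=> // /weaveP[w ->].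
  by rewrite path_size_weave path_altitude_weave; lia.
(* Least possible numbers of [E] and [Ebar] for altitude [k]. Adding [i] to both keeps the altitude,
   and [h - i] pairs then give size [|k| + 2 * h]. *)
pose a := if 0 <= k then 0%N else `|k|%N; pose c := if 0 <= k then `|k|%N else 0%N.
pose W i := [seq zip u v | u <- bits (h - i) (a + i), v <- bits (h - i) (c + i)].
rewrite (@set_card_seq _ [seq weave w | i <- iota 0 h.+1, w <- W i]).
- rewrite size_allpairs_dep sumnE big_map /index_iota subn0; apply: eq_bigr => i _.
  (* For negative [k] the two binomials come in the opposite order. *)
  rewrite size_allpairs !size_bits /a /c; case: ifP => _ //.
  by rewrite mulnC.
- apply: allpairs_uniq_dep; first exact: iota_uniq.
    by move=> i _; exact: uniq_zip_bits.
  (* The index [i] can be read off the length [h - i] of the word, as [i <= h]; hence different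
     indices give disjoint blocks. *)
  have tagE (t : {_ : nat & seq (bool * bool)}) :
      t \in [seq existT (fun _ : nat => seq (bool * bool)) i w
             | i <- iota 0 h.+1, w <- W i] ->
      tag t = (h - size (tagged t))%N.
    case/allpairsPdep => i [w [hi]]; rewrite mem_iota in hi.
    by rewrite /W mem_zip_bits => /and3P[/eqP sw _ _] -> /=; rewrite sw; lia.
  by move=> [i w] [j w'] /tagE/= -> /tagE/= -> /weave_inj ->.
- move=> p; rewrite weaveP; split=> [[w ->]|/allpairsPdep[i [w [hi]]]].
    rewrite path_size_weave path_altitude_weave => hw.
    (* The size and altitude equations force the number of pairs plus the smaller of the two counts
       to be [h]. *)
    apply/allpairsPdep; exists (h - size w)%N, w.
    rewrite mem_iota /W mem_zip_bits /a /c.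
    by case: ifP hw => hk hw; split=> //; lia.
  rewrite mem_iota in hi.
  rewrite /W mem_zip_bits => hw ->; exists w => //.
  rewrite path_size_weave path_altitude_weave.
  by move: hw; rewrite /a /c; case: ifP => hk; lia.
Qed.

(** * Reflection in the horizontal axis *)

Definition flip (s : int * int) : int * int := (s.1, - s.2).

Lemma flipK : involutive flip.
Proof. by case=> x y; rewrite /flip opprK. Qed.

Lemma flip_zigzag n k p : zigzag n k p -> zigzag n (- k) (map flip p).
Proof.
have knight s : s \in knight_steps ->
    flip s \in knight_steps /\ is_up (flip s) = ~~ is_up s.
  by rewrite !inE => /or4P[] /eqP->.
case=> zp <- <-; split.
- elim: p zp => // s p IHp; rewrite map_cons !grand_zigzag_cons.
  case/and3P=> /knight[-> us] zp hp; rewrite IHp //=; case: p zp hp {IHp} => //= t p.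
  by rewrite grand_zigzag_cons => /andP[/knight[_ ->] _]; rewrite us; do 2!case: is_up.
- by rewrite /path_size big_map.
- by rewrite /path_altitude big_map /= sumrN.
Qed.

Lemma zigzag_minus_flip n k :
  zigzag_minus n k = (map flip @` zigzag_plus n (- k))%classic.
Proof.
apply/seteqP; split=> [p [zp hp]|_ [p [zp hp] <-]].
  exists (map flip p); last exact: mapK flipK p.
  split; first exact: flip_zigzag.
  by case: p hp {zp} => //= s p; rewrite !inE => /orP[] /eqP->.
split; first by rewrite -(opprK k); apply: flip_zigzag.
by case: p hp {zp} => //= s p; rewrite !inE => /orP[] /eqP->.
Qed.

Lemma set_card_zigzag_minusE n k :
  set_card (zigzag_minus n k) = set_card (zigzag_plus n (- k)).
Proof.
rewrite zigzag_minus_flip set_card_image //; last exact: finite_zigzag_plus.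
exact: inj_map (inv_inj flipK).
Qed.

Lemma set_card_zigzag_minus (n k : int) :
  (n = k %[mod 2])%Z -> set_card (zigzag_minus n k) = Ssum n k.
Proof.
move=> nk; rewrite set_card_zigzag_minusE set_card_zigzag_plus; last lia.
(* [Ssum] depends on its second argument only through the absolute value. *)
by rewrite /Ssum normrN abszN.
Qed.

Lemma set_card_zigzag (n k : int) : (n, k) <> (0, 0) ->
  set_card (zigzag n k) =
  (set_card (zigzag_plus n k) + set_card (zigzag_minus n k))%N.
Proof.
move=> nk0; rewrite -set_card_setU; first last.
- case=> [|s p] [[_ hn hk] up] [_ down].
    (* Only the empty path lies in both sets, and it has size and altitude 0. *)
    by apply: nk0; rewrite -hn -hk /path_size /path_altitude !big_nil.
  by move: up down; rewrite !inE => /orP[] /eqP->.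
- exact: finite_zigzag_minus.
- exact: finite_zigzag_plus.
congr set_card; apply/seteqP; split=> [p zp|p [] [] //].
case: p zp => [|s p] zp; first by left.
have hs : s \in knight_steps by case: zp => /andP[/andP[]].
move: (hs); rewrite !inE => /or4P[] /eqP e; [left | right | left | right];
  by split=> //; rewrite e.
Qed.

(** * Deleting the last step of a path of odd length *)

Lemma zigzag_last s p : grand_zigzag (s :: p) ->
  is_up (last s p) = is_up s (+) odd (size p).
Proof.
elim: p s => [|t p IHp] s; first by rewrite addbF.
rewrite grand_zigzag_cons => /and3P[_ /IHp /= -> ].
by case: (is_up s) (is_up t) (odd _) => [] [] [].
Qed.

Lemma grand_zigzag_rcons p s :
  grand_zigzag (rcons p s) =
  [&& grand_zigzag p, s \in knight_steps &
      if p is t :: q then is_up (last t q) != is_up s else true].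
Proof.
rewrite /grand_zigzag all_rcons; case: p => [|t p] /=; first by rewrite !andbT.
by rewrite rcons_path -!andbA; do !bool_congr.
Qed.

(** If [p] is nonempty of even length and starts upwards, it ends downwards, so the appended step
    must go up; if [p] is empty, that step is itself the first. *)
Lemma even_zigzag_rcons p s : s \in knight_steps -> ~~ odd (size p) ->
  grand_zigzag (rcons p s) && starts_up (rcons p s) =
  [&& grand_zigzag p, starts_up p & is_up s].
Proof.
move=> hs; rewrite grand_zigzag_rcons hs /=.
case: p => [|t p] //=; rewrite negbK => odd_p.
case zp: (grand_zigzag _) => //=; rewrite (zigzag_last _ _ zp) odd_p.
by do 2!case: is_up.
Qed.

Lemma zigzag_plus_rcons n k p s : s \in knight_steps -> (n != k %[mod 2])%Z ->
  zigzag_plus n k (rcons p s) <->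
  zigzag_plus (n - s.1) (k - s.2) p /\ is_up s.
Proof.
move=> hs nk; rewrite !zigzag_plusE.
have sizeE : path_size (rcons p s) = path_size p + s.1.
  by rewrite /path_size -cats1 big_cat big_seq1.
have altE : path_altitude (rcons p s) = path_altitude p + s.2.
  by rewrite /path_altitude -cats1 big_cat big_seq1.
split=> [[zp up]|[[zp up] us]].
  have := zigzag_odd _ _ _ zp; rewrite size_rcons nk /= => evp.
  case: zp => zp hn hk; have := even_zigzag_rcons p s hs evp.
  rewrite zp up => /esym/and3P[zp' up' us]; split=> //; split=> //.
  by split=> //; rewrite -?hn -?hk ?sizeE ?altE addrK.
have evp : ~~ odd (size p).
  rewrite (zigzag_odd _ _ _ zp) negbK.
  (* Removing a step changes the sum of size and altitude by an odd number, so the shifted indices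
     agree modulo 2. *)
  by move: hs nk; rewrite !inE => /or4P[] /eqP-> /=; lia.
case: zp => zp hn hk; have := even_zigzag_rcons p s hs evp.
rewrite zp up us => /andP[zp' up']; split=> //; split=> //.
  by rewrite sizeE hn subrK.
by rewrite altE hk subrK.
Qed.

Lemma set_card_zigzag_plus_odd (n k : int) : (n <> k %[mod 2])%Z ->
  set_card (zigzag_plus n k) =
  (set_card (zigzag_plus (n - 1) (k - 2)) +
   set_card (zigzag_plus (n - 2) (k - 1)))%N.
Proof.
move/eqP=> nk; have finP := finite_zigzag_plus.
rewrite -(set_card_image (rcons^~ stepN) (zigzag_plus (n - 1) _)) //;
  last exact: rcons_injl.
rewrite -(set_card_image (rcons^~ stepE) (zigzag_plus (n - 2) _)) //;
  last exact: rcons_injl.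
rewrite -set_card_setU; first last.
- by move=> _ [p _ <-] [q _ /rcons_inj[]].
- exact: finite_image.
- exact: finite_image.
congr set_card; apply/seteqP; split=> [p|_ [[p zp <-]|[p zp <-]]].
- case: (lastP p) => [|q s] zp.
    by case: zp => zp _; move: (zigzag_odd _ _ _ zp); rewrite nk.
  have hs : s \in knight_steps.
    by case: zp => -[/andP[]]; rewrite all_rcons => /andP[].
  move: zp; rewrite zigzag_plus_rcons // => -[zp us].
  by case: (up_step _ hs us) zp => -[] -> zp; [right | left]; exists q.
- exact/zigzag_plus_rcons.
- exact/zigzag_plus_rcons.
Qed.

Theorem theorem3p2 (n k : int) (hn : 0 <= n) :
  ((n = k %[mod 2])%Z -> (n, k) <> (0, 0) ->
    set_card (zigzag n k) = (2 * Ssum n k)%N) /\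
  ((n <> k %[mod 2])%Z ->
    set_card (zigzag n k) =
      (set_card (zigzag_plus (n - 1) (k - 2)) + set_card (zigzag_plus (n - 2) (k - 1)) +
       set_card (zigzag_minus (n - 1) (k + 2)) + set_card (zigzag_minus (n - 2) (k + 1)))%N /\
    [/\ set_card (zigzag_plus (n - 1) (k - 2)) = Ssum (n - 1) (k - 2),
        set_card (zigzag_plus (n - 2) (k - 1)) = Ssum (n - 2) (k - 1),
        set_card (zigzag_minus (n - 1) (k + 2)) = Ssum (n - 1) (k + 2) &
        set_card (zigzag_minus (n - 2) (k + 1)) = Ssum (n - 2) (k + 1)]).
Proof.
split=> nk.
  move=> nk0; rewrite set_card_zigzag // set_card_zigzag_plus //.
  by rewrite set_card_zigzag_minus // mul2n addnn.
split; last first.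
  by split; rewrite ?set_card_zigzag_plus ?set_card_zigzag_minus //; lia.
(* Differing parities already exclude the pair [(0, 0)]. *)
rewrite set_card_zigzag; last by move=> [n0 k0]; apply: nk; rewrite n0 k0.
rewrite set_card_zigzag_plus_odd // !set_card_zigzag_minusE.
rewrite (set_card_zigzag_plus_odd n (- k)); last lia.
by rewrite !opprD !addnA.
Qed.
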